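(* Let $B \ge 2$ be an integer base. Then the number of solutions of $P^*_k$ in base $B$ becomes constant beyond $k = \max\{5,\, 2\log_2(B-1)+2\}$; that is, the number of numbers $N_k = [a_1\dots a_k\, b\, c_1\dots c_k]$ with $a_1\neq 0$ having property $P^*_k$ is the same for all integers $k \ge \max\{5,\, 2\log_2(B-1)+2\}$.
   Context: Fix an integer base $B \ge 2$. A digit is an integer $x$ with $0 \le x < B$, and for digits $x_1,\dots,x_m$ write $[x_1x_2\dots x_m] = \sum_{i=1}^m x_i B^{m-i}$. For $k \ge 1$ consider a number $N_k = [a_1\dots a_k\, b\, c_1\dots c_k]$ with digits $a_i, b, c_i$ and $a_1 \neq 0$, and put $a = [a_1\dots a_k]$, $c = [c_1\dots c_k]$. $N_k$ has property $P_k$ if $[a_1\dots a_k\, b]\cdot[c_1\dots c_k] = [a_1\dots a_k]\cdot[b\, c_1\dots c_k]$, equivalently $(aB+b)c = a(bB^k + c)$. $N_k$ has property $P^*_k$ (is a solution of $P^*_k$) if it has property $P_k$, no two of $a, b, c$ are $0$, and the digits $a_1,\dots,a_k,b,c_1,\dots,c_k$ are not all equal. *)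

(* Defs.v *)
From mathcomp Require Import all_boot all_order all_algebra.
From mathcomp Require Import all_classical all_reals all_analysis.

Set Implicit Arguments.
Unset Strict Implicit.
Unset Printing Implicit Defensive.

Import Order.TTheory GRing.Theory Num.Theory.

Definition is_digit (B x : nat) : bool := x < B.

(* [x_1 ... x_m] in base B, most significant digit first: the 0-based index i
   of the sequence carries the digit x_(i+1), hence the weight B^(m-(i+1)). *)
Definition digits_val (B : nat) (x : seq nat) : nat :=
  \sum_(i < size x) nth 0 x i * B ^ (size x - i.+1).

(* N = [a_1 ... a_k b c_1 ... c_k] with base-B digits and a_1 <> 0. *)
Definition is_expansion (B k N : nat) (a : seq nat) (b : nat) (c : seq nat) :
    Prop :=
  [/\ size a = k, size c = k, all (is_digit B) (a ++ b :: c),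
      head 0 a <> 0 & N = digits_val B (a ++ b :: c)].

Definition has_P (B : nat) (a : seq nat) (b : nat) (c : seq nat) : Prop :=
  digits_val B (rcons a b) * digits_val B c =
  digits_val B a * digits_val B (b :: c).

Definition no_two_zero (x y z : nat) : Prop :=
  [/\ ~ (x = 0 /\ y = 0), ~ (x = 0 /\ z = 0) & ~ (y = 0 /\ z = 0)].

Definition has_Pstar (B : nat) (a : seq nat) (b : nat) (c : seq nat) : Prop :=
  [/\ has_P B a b c,
      no_two_zero (digits_val B a) b (digits_val B c)
    & ~~ constant (a ++ b :: c)].

(* The expansion of N is unique, so the existential merely names its digits. *)
Definition Pstar_solution (B k N : nat) : Prop :=
  exists (a : seq nat) (b : nat) (c : seq nat),
    is_expansion B k N a b c /\ has_Pstar B a b c.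

Definition log2 (R : realType) (x : R) : R := (ln x / ln 2)%R.

(* Main.v *)
Require Import Defs.
From mathcomp Require Import all_boot all_order all_algebra zify ring.
From mathcomp Require Import all_classical all_reals all_analysis.

(** Why the number of solutions stabilises.  Write a solution as a triple of
    numbers (a, b, c), and put D = (B - 1) a + b.  Property P is then equivalent
    to c D = a b B^k, and under this equation all digits are equal exactly when
    a = c (then D = b B^k, so a and c are both the number b b ... b).

    Inserting two more digits b in the middle sends [a b c], a solution for k,
    to [ab b bc], a solution for k + 1: a becomes aB + b = D + a, c becomes
    b B^k + c, D becomes B D, and the equation c D = a b B^k is preserved in
    both directions (lemma [insert_solution]).  So the map [insert_mid] is
    injective from the solutions for k to the solutions for k + 1, and a
    solution (a', b, c') for k + 1 is in its image as soon as B divides its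
    D' = (B - 1) a' + b: this says that a' ends with the digit b, and the
    equation then forces c' to begin with b.

    That divisibility holds for k large.  From c' D' = a' b B^(k+1) it follows
    that D' e = b^2 B^(k+1) with e = b B^(k+1) - (B - 1) c'.  Since
    D' > B^k (B - 1) and b <= B - 1, the cofactor e is less than B (B - 1).  As
    soon as B (B - 1) <= 2^k, a prime that divides B with exponent v > 0 has
    therefore an exponent less than k in e, and one of at least (k + 1) v in
    D' e; so its exponent in D' is at least v (lemma
    [dvdn_base_of_small_cofactor]).  Finally k >= 2 log2 (B - 1) + 2 gives
    2^k >= 4 (B - 1)^2 >= B (B - 1). *)

Set Implicit Arguments.
Unset Strict Implicit.
Unset Printing Implicit Defensive.

Import Order.TTheory GRing.Theory Num.Theory.

Local Open Scope classical_set_scope.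
Local Open Scope card_scope.

(** * Positional notation *)

Lemma digits_val_rcons B s x :
  digits_val B (rcons s x) = digits_val B s * B + x.
Proof.
rewrite /digits_val size_rcons big_ord_recr /= nth_rcons ltnn eqxx subnn muln1.
congr (_ + _); rewrite big_distrl; apply: eq_bigr => i _ /=.
by rewrite nth_rcons ltn_ord -mulnA -expnSr subSn.
Qed.

Lemma digits_val_cat B s t :
  digits_val B (s ++ t) = digits_val B s * B ^ size t + digits_val B t.
Proof.
elim/last_ind: t => [|t x IHt].
  by rewrite cats0 muln1 {3}/digits_val big_ord0 addn0.
rewrite -rcons_cat !digits_val_rcons IHt size_rcons expnSr; ring.
Qed.

Lemma digits_val_cons B x s :
  digits_val B (x :: s) = x * B ^ size s + digits_val B s.
Proof.
by rewrite -cat1s digits_val_cat {1}/digits_val big_ord1 /= muln1.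
Qed.

Lemma digits_val_lt B s :
  all (is_digit B) s -> digits_val B s < B ^ size s.
Proof.
elim: s => [|x s IHs] /=; first by rewrite /digits_val big_ord0.
case/andP=> xB /IHs lts; rewrite digits_val_cons expnS.
have := leq_mul xB (leqnn (B ^ size s)); rewrite mulSn; lia.
Qed.

Lemma digits_of_lt B k n : n < B ^ k ->
  exists s, [/\ size s = k, all (is_digit B) s & digits_val B s = n].
Proof.
elim: k n => [|k IHk] n ltn.
  by exists [::]; split=> //; rewrite /digits_val big_ord0; move: ltn; case: n.
have B0 : 0 < B by case: B ltn {IHk} => //; rewrite exp0n.
have [|s [sk sB sn]] := IHk (n %/ B); first by rewrite ltn_divLR // -expnSr.
exists (rcons s (n %% B)); split; first by rewrite size_rcons sk.
  by rewrite all_rcons sB /is_digit ltn_mod B0.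
by rewrite digits_val_rcons sn -divn_eq.
Qed.

Lemma digits_val_inj B s t : size s = size t ->
  all (is_digit B) s -> all (is_digit B) t ->
  digits_val B s = digits_val B t -> s = t.
Proof.
elim/last_ind: s t => [|s x IHs] t; first by case: t.
elim/last_ind: t => [|t y _]; first by rewrite size_rcons.
rewrite !size_rcons !all_rcons !digits_val_rcons.
move=> [szE] /andP[xB sB] /andP[yB tB] valE.
have B0 : 0 < B by apply: leq_ltn_trans xB.
have xyE : x = y.
  by have := congr1 (modn^~ B) valE; rewrite !modnMDl !modn_small.
move: valE; rewrite xyE => /addIn /eqP; rewrite eqn_pmul2r // => /eqP valE.
by rewrite (IHs t).
Qed.

Lemma digits_val_nseq B k b :
  0 < B -> digits_val B (nseq k b) * (B - 1) + b = b * B ^ k.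
Proof.
move=> B0; elim: k => [|k IHk]; first by rewrite /digits_val big_ord0 muln1.
rewrite -[k.+1]addn1 nseqD cats1 digits_val_rcons addn1 expnSr mulnA -IHk.
case: B B0 {IHk} => // B _; rewrite subn1 /=; ring.
Qed.

Lemma head_neq0 B k s : 0 < k -> size s = k -> all (is_digit B) s ->
  head 0 s <> 0 <-> B ^ k.-1 <= digits_val B s.
Proof.
case: k s => // k [|x s] //= _ [<-] /andP[_ /digits_val_lt sB].
rewrite digits_val_cons.
split=> [/eqP|]; last first.
  by move=> le_s x0; move: le_s; rewrite x0 mul0n add0n leqNgt sB.
rewrite -lt0n => x0; apply: leq_trans (leq_addr _ _).
by rewrite leq_pmull.
Qed.

(** * Solutions as triples of numbers *)

(** The equation of property P reads c = a b B^k / ((B - 1) a + b), whence the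
    name. *)
Definition denom B (a b : nat) : nat := a * (B - 1) + b.

(** The lower bound on [a] says that its leading digit is nonzero.  Since [a] is
    positive, no two of [a], [b], [c] vanish iff [b] is nonzero (the equation
    gives [c = 0] when [b = 0], and conversely); and [a <> c] stands for the
    digits not being all equal, see [constant_digitsP]. *)
Definition solution_triples B k : set (nat * nat * nat) := [set t |
  let: (a, b, c) := t in
  [/\ B ^ k.-1 <= a < B ^ k, 0 < b < B, c < B ^ k,
      c * denom B a b = a * b * B ^ k & a <> c]].

Definition join_digits B k (t : nat * nat * nat) : nat :=
  let: (a, b, c) := t in (a * B + b) * B ^ k + c.

Lemma has_P_valE B (a b c X : nat) : 0 < B ->
  (a * B + b) * c = a * (b * X + c) <-> c * denom B a b = a * b * X.
Proof.
rewrite /denom; case: B => // q _; rewrite subn1 /=.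
have -> : (a * q.+1 + b) * c = c * (a * q + b) + a * c by ring.
have -> : a * (b * X + c) = a * b * X + a * c by ring.
by split=> [/addIn|->].
Qed.

Lemma denom_diag B (a b X : nat) : 0 < a ->
  a * denom B a b = a * b * X -> denom B a b = b * X.
Proof. by move=> a0 /eqP; rewrite -mulnA eqn_pmul2l // => /eqP. Qed.

(** With property P, a = c gives (B - 1) a + b = b B^k, the equation that
    characterises the number written with k digits b; so both a and c are
    that number. *)
Lemma constant_digitsP B k a b c : 1 < B -> size a = k -> size c = k ->
    all (is_digit B) (a ++ b :: c) -> 0 < digits_val B a ->
    digits_val B c * denom B (digits_val B a) b = digits_val B a * b * B ^ k ->
  constant (a ++ b :: c) <-> digits_val B a = digits_val B c.
Proof.
move=> B2 ak ck; rewrite all_cat /= => /and3P[aB bB cB] a0 balE; split.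
  case: a ak aB a0 {balE} => [|x a] ak aB a0.
    by move: a0; rewrite /digits_val big_ord0 ltnn.
  rewrite /= all_cat /= => /and3P[/all_pred1P aE /eqP bE /all_pred1P cE].
  congr digits_val; rewrite cE ck -ak /=; congr (_ :: _); exact: aE.
move=> acE; move: balE; rewrite -acE => /(denom_diag a0) balE.
have nB : all (is_digit B) (nseq k b) by rewrite all_nseq bB orbT.
have valE : digits_val B a = digits_val B (nseq k b).
  have := digits_val_nseq k b (ltnW B2); rewrite -balE /denom => /addIn /eqP.
  by rewrite eqn_pmul2r ?subn_gt0 // => /eqP.
have aE : a = nseq k b by apply: digits_val_inj valE; rewrite ?ak ?size_nseq.
have cE : c = nseq k b.
  by apply: (@digits_val_inj B); rewrite ?ck ?size_nseq // -acE.
rewrite aE cE; apply/(@constantP _ b); exists b.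
by rewrite size_cat /= size_nseq -[b :: _]/(nseq k.+1 b) -nseqD.
Qed.

(** Together with [join_digits_inj], this lets the count of solutions be made on
    triples of numbers. *)
Lemma Pstar_solutionsE B k : 2 <= B -> 0 < k ->
  [set N | Pstar_solution B k N] = join_digits B k @` solution_triples B k.
Proof.
move=> B2 k0; have B0 : 0 < B by apply: ltnW.
have Bk0 : 0 < B ^ k.-1 by rewrite expn_gt0 B0.
apply/seteqP; split=> [N [a [b [c [[ak ck dB h0 NE] [PE zE ncst]]]]] |].
  have /and3P[aB bB cB] : [&& all (is_digit B) a, b < B & all (is_digit B) c].
    by move: dB; rewrite all_cat.
  have aval := (head_neq0 k0 ak aB).1 h0.
  have a0 := leq_trans Bk0 aval.
  have PE' : digits_val B c * denom B (digits_val B a) b =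
             digits_val B a * b * B ^ k.
    apply/has_P_valE => //.
    by move: PE; rewrite /has_P digits_val_rcons digits_val_cons ck.
  exists (digits_val B a, b, digits_val B c); last first.
    by rewrite NE /join_digits digits_val_cat digits_val_cons /= ck expnS; ring.
  split=> //; first by rewrite aval -ak digits_val_lt.
  - rewrite bB andbT lt0n; apply/eqP => b0; move: PE'; rewrite b0 muln0 mul0n.
    move/eqP; rewrite muln_eq0 /denom addn0 muln_eq0 (gtn_eqF a0).
    rewrite subn_eq0 leqNgt B2 orbF.
    by move/eqP => c0; case: zE => _ _; apply.
  - by rewrite -ck digits_val_lt.
  - by move/(constant_digitsP B2 ak ck dB a0 PE') => cst; rewrite cst in ncst.
move=> _ [[[a b] c] [/andP[aL aU] /andP[b0 bB] cU PE ac] <-].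
have [sa [sak saB saE]] := digits_of_lt aU.
have [sc [sck scB scE]] := digits_of_lt cU.
have dB : all (is_digit B) (sa ++ b :: sc).
  by rewrite all_cat /= saB scB /is_digit bB.
have a0 := leq_trans Bk0 aL.
exists sa, b, sc; split; first split=> //.
- by apply/(head_neq0 k0 sak saB); rewrite saE.
- rewrite /join_digits digits_val_cat digits_val_cons /= sck expnS saE scE.
  by ring.
split.
- rewrite /has_P digits_val_rcons digits_val_cons sck saE scE.
  exact/has_P_valE.
- by split=> -[]; lia.
- apply/negP => /(constant_digitsP B2 sak sck dB).
  by rewrite saE scE => /(_ a0 PE).
Qed.

Lemma join_digits_inj B k :
  {in solution_triples B k &, injective (join_digits B k)}.
Proof.
move=> [[a b] c] [[a' b'] c'] /set_mem[aB /andP[_ bB] cB _ _].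
move=> /set_mem[a'B /andP[_ b'B] c'B _ _] /= E.
have B0 : 0 < B by apply: leq_ltn_trans bB.
have Bk0 : 0 < B ^ k by rewrite expn_gt0 B0.
have cE : c = c'.
  by have := congr1 (modn^~ (B ^ k)) E; rewrite !modnMDl !modn_small.
move: E; rewrite cE => /addIn /eqP; rewrite eqn_pmul2r // => /eqP E.
have bE : b = b' by have := congr1 (modn^~ B) E; rewrite !modnMDl !modn_small.
by move: E; rewrite bE => /addIn /eqP; rewrite eqn_pmul2r // => /eqP ->.
Qed.

(** * Inserting two digits in the middle *)

(** In digits, [a b c] becomes [ab b bc]. *)
Definition insert_mid B k (t : nat * nat * nat) : nat * nat * nat :=
  let: (a, b, c) := t in (a * B + b, b, b * B ^ k + c).

Lemma insert_mid_inj B k : 0 < B -> injective (insert_mid B k).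
Proof.
move=> B0 [[a b] c] [[a' b'] c'] [] + bE; rewrite bE => /addIn /eqP.
by rewrite eqn_pmul2r // => /eqP -> /addnI ->.
Qed.

Lemma denom_insert B a b : 0 < B -> denom B (a * B + b) b = B * denom B a b.
Proof. by rewrite /denom; case: B => // q _; rewrite subn1 /=; ring. Qed.

Lemma append_digitE B a b : 0 < B -> a * B + b = denom B a b + a.
Proof. by rewrite /denom; case: B => // q _; rewrite subn1 /=; ring. Qed.

(** Up to a common factor B, the insertion adds b X D to both sides of
    c D = a b X, where X is B^k and D the denominator. *)
Lemma insert_solution B (a b c X : nat) : 0 < B -> 0 < denom B a b ->
  (b * X + c) * denom B (a * B + b) b = (a * B + b) * b * (B * X) <->
  c * denom B a b = a * b * X.
Proof.
move=> B0 D0; rewrite denom_insert // (@append_digitE B) //.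
set D := denom B a b.
have -> : (b * X + c) * (B * D) = B * (b * X * D + c * D) by ring.
have -> : (D + a) * b * (B * X) = B * (b * X * D + a * b * X) by ring.
by split=> [/eqP|->//]; rewrite eqn_pmul2l // eqn_add2l => /eqP.
Qed.

(** With D the denominator, the left equation is D + a = b X + c, while
    c D = a (b X).  If for instance c < a, the first gives D < b X, against the
    second. *)
Lemma insert_nontrivial B (a b c X : nat) : 0 < B -> 0 < a -> 0 < b * X ->
  c * denom B a b = a * b * X -> a * B + b = b * X + c <-> a = c.
Proof.
move=> B0 a0 X0 E; rewrite (@append_digitE B) //.
split=> [DE|ac]; last first.
  by rewrite -ac in E *; rewrite (denom_diag a0 E).
move: E; rewrite -mulnA; move: (denom B a b) (b * X) DE X0 => D Y DE Y0 E.
case: (ltngtP a c) => // ac; nia.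
Qed.

(** * Divisibility of the denominator by the base *)

(** It is enough that [e] divides [m * B ^ k], which is checked one prime [p] at
    a time.  If [p] divides [B], then [p] occurs fewer than [k] times in [e] as
    [e < 2 ^ k], and at least [k] times in [B ^ k].  Otherwise [p] does not
    divide [B ^ k.+1], so the [p]-part of [e] divides [m]. *)
Lemma dvdn_base_of_small_cofactor B m D e k :
  0 < B -> 0 < m -> e < 2 ^ k -> D * e = m * B ^ k.+1 -> B %| D.
Proof.
move=> B0 m0 e2 DeE.
have De0 : 0 < D * e by rewrite DeE muln_gt0 m0 expn_gt0 B0.
have /andP[D0 e0] : (0 < D) && (0 < e) by rewrite -muln_gt0.
have Bk0 : 0 < B ^ k by rewrite expn_gt0 B0.
have /dvdnP[q qE] : e %| m * B ^ k.
  apply/dvdn_partP => // p; rewrite mem_primes => /and3P[pP _ _].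
  rewrite p_part pfactor_dvdn ?muln_gt0 ?m0 // lognM // lognX.
  have [pB|pNB] := boolP (p %| B).
    have vB : 0 < logn p B by rewrite logn_gt0 mem_primes pP B0.
    have vek : logn p e < k.
      rewrite -(ltn_exp2l _ _ (ltnSn 1)); apply: leq_ltn_trans e2.
      apply: leq_trans (dvdn_leq e0 (pfactor_dvdnn p e)).
      by case: (logn p e) => // v; rewrite leq_exp2r // prime_gt1.
    by apply: (leq_trans (ltnW vek)); nia.
  have vB0 : logn p B = 0.
    by apply/eqP; rewrite -leqn0 leqNgt logn_gt0 mem_primes pP B0.
  have := congr1 (logn p) DeE.
  rewrite !lognM ?expn_gt0 ?B0 // lognX vB0 !muln0; lia.
apply/dvdnP; exists q; apply/eqP; rewrite -(eqn_pmul2r e0) DeE expnSr mulnA qE.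
by apply/eqP; ring.
Qed.

(** The denominator D exceeds B^k (B - 1) and b is at most B - 1, so that in
    D e = b^2 B^(k+1) the cofactor e is less than B (B - 1). *)
Lemma dvdn_base_denom B k a b c : 2 <= B -> B * (B - 1) <= 2 ^ k ->
  solution_triples B k.+1 (a, b, c) -> B %| denom B a b.
Proof.
move=> B2 Bk [/andP[aL aU] /andP[b0 bB] cU E _].
have B0 : 0 < B by apply: ltnW.
have Bk0 : 0 < B ^ k by rewrite expn_gt0 B0.
set D := denom B a b in E *.
have /dvdnP[e eE] : D %| b ^ 2 * B ^ k.+1.
  (* b^2 B^(k+1) = b B^(k+1) D - (B - 1) (a b B^(k+1)), and both terms are
     multiples of D, the second one by the equation. *)
  rewrite -(@dvdn_addr ((B - 1) * (a * b * B ^ k.+1))); last first.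
    by rewrite -E dvdn_mull // dvdn_mull.
  have -> : (B - 1) * (a * b * B ^ k.+1) + b ^ 2 * B ^ k.+1 = b * B ^ k.+1 * D.
    by rewrite /D /denom; ring.
  exact: dvdn_mull.
have DL : B ^ k * (B - 1) < D.
  by rewrite /D /denom -[X in X < _]addn0 -addnS leq_add // leq_mul2r aL orbT.
apply: (@dvdn_base_of_small_cofactor B (b ^ 2) D e k) => //.
- by rewrite expn_gt0 b0.
- apply: leq_trans Bk; rewrite ltnNge; apply/negP => eL.
  have : B * (B - 1) * (B ^ k * (B - 1)) < e * D.
    by apply: leq_ltn_trans (_ : e * (B ^ k * (B - 1)) < _);
       rewrite ?leq_mul2r ?eL ?orbT // ltn_pmul2l //; nia.
  rewrite -eE ltnNge => /negP; apply.
  have bB1 : b <= B - 1 by lia.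
  have -> : B * (B - 1) * (B ^ k * (B - 1)) = (B - 1) ^ 2 * B ^ k.+1.
    by rewrite [B ^ k.+1]expnS; ring.
  by rewrite leq_mul2r leq_exp2r // bB1 orbT.
- by rewrite mulnC.
Qed.

(** * The number of solutions *)

(** Only the surjectivity of the insertion has content: it comes down to the
    divisibility by B of the denominator of every solution for k + 1. *)
Lemma solution_triples_succ B k : 2 <= B -> B * (B - 1) <= 2 ^ k ->
  solution_triples B k.+1 = insert_mid B k @` solution_triples B k.
Proof.
move=> B2 Bk; have B0 : 0 < B by apply: ltnW.
have k0 : 0 < k by case: k Bk => //; nia.
have Bk0 : 0 < B ^ k by rewrite expn_gt0 B0.
have Bk10 : 0 < B ^ k.-1 by rewrite expn_gt0 B0.
have BkE : B ^ k = B ^ k.-1 * B by rewrite -expnSr prednK.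
apply/seteqP; split=> [[[a' b] c'] tC|_ [[[a b] c] [aB bB cB E ac] <-]].
  have dD := dvdn_base_denom B2 Bk tC.
  case: tC => a'B bB c'B E ac'.
  have /andP[b0 b1] := bB.
  (* Modulo B, the denominator is b - a', so that a' ends with the digit b. *)
  have [a aE] : exists a, a' = a * B + b.
    exists (a' %/ B); rewrite {1}(divn_eq a' B); congr (_ + _).
    rewrite -[RHS](modn_small b1); apply/eqP.
    rewrite -(eqn_modDl (a' * (B - 1))) -/(denom B a' b) (eqP dD).
    by rewrite -mulnSr subn1 prednK // modnMl.
  subst a'.
  have D0 : 0 < denom B a b by rewrite /denom addn_gt0 b0 orbT.
  have aB : B ^ k.-1 <= a < B ^ k.
    move: a'B => /=; rewrite expnSr => /andP[aL aU]; apply/andP; split.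
      by rewrite -ltnS -(ltn_pmul2r B0) -BkE mulSn; lia.
    by rewrite -(ltn_pmul2r B0); lia.
  have a0 : 0 < a by case/andP: aB => aL _; apply: leq_trans aL.
  have [c cE] : exists c, c' = b * B ^ k + c.
    (* With D the denominator of (a, b), the equation divided by B reads
       c' D = b B^k D + a b B^k, so c' is at least b B^k. *)
    exists (c' - b * B ^ k); rewrite subnKC // -(leq_pmul2r D0).
    rewrite -(leq_pmul2l B0) [leqRHS]mulnCA -denom_insert // E.
    rewrite expnS (@append_digitE B) //; set D := denom B a b.
    have -> : (D + a) * b * (B * B ^ k) = B * (b * B ^ k * D + a * b * B ^ k).
      by ring.
    by rewrite leq_pmul2l // leq_addr.
  subst c'; rewrite expnS in E; move/(insert_solution _ _ B0 D0): E => E.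
  have X0 : 0 < b * B ^ k by rewrite muln_gt0 b0.
  exists (a, b, c); last by [].
  split=> //.
    rewrite -(ltn_pmul2r D0) E mulnC ltn_pmul2l // /denom; nia.
  by move=> ac; apply: ac'; apply/(insert_nontrivial B0 a0 X0 E).
have /andP[b0 b1] := bB; have /andP[aL aU] := aB.
have a0 : 0 < a by apply: leq_trans aL.
have D0 : 0 < denom B a b by rewrite /denom addn_gt0 b0 orbT.
have X0 : 0 < b * B ^ k by rewrite muln_gt0 b0.
split=> //=.
- apply/andP; split; first by rewrite BkE; nia.
  by rewrite expnSr; nia.
- by rewrite expnS; nia.
- by rewrite expnS; apply/insert_solution.
- by move/(insert_nontrivial B0 a0 X0 E).
Qed.

Lemma Pstar_solutions_finite B k : finite_set [set N | Pstar_solution B k N].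
Proof.
apply: (@sub_finite_set _ _ `I_(B ^ (k + k.+1))); last exact: finite_II.
move=> N [a [b [c [[ak ck /digits_val_lt dB _ ->] _]]]] /=.
by move: dB; rewrite size_cat /= ak ck.
Qed.

Lemma Pstar_solutions_succ B k : 2 <= B -> B * (B - 1) <= 2 ^ k ->
  [set N | Pstar_solution B k.+1 N] #= [set N | Pstar_solution B k N].
Proof.
move=> B2 Bk; have B0 : 0 < B by apply: ltnW.
have k0 : 0 < k by case: k Bk => //; nia.
rewrite !Pstar_solutionsE //.
apply: card_eq_trans (inj_card_eq (@join_digits_inj B k.+1)) _.
apply: card_esym; apply: card_eq_trans (inj_card_eq (@join_digits_inj B k)) _.
rewrite solution_triples_succ //; apply: card_esym; apply: inj_card_eq.
by move=> s t _ _; apply: insert_mid_inj.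
Qed.

(** The logarithmic bound says that 4 (B - 1)^2 <= 2^k, and B <= 4 (B - 1). *)
Lemma log2_threshold (R : realType) B k : 2 <= B ->
  (2 * log2 (B%:R - 1 : R) + 2 <= k%:R)%R -> B * (B - 1) <= 2 ^ k.
Proof.
move=> B2 le_k.
suff le4 : 4 * (B - 1) ^ 2 <= 2 ^ k by apply: leq_trans le4; nia.
have B10 : 0 < B - 1 by rewrite subn_gt0.
have ln20 : (0 < ln 2 :> R)%R by rewrite ln_gt0 // ltr1n.
have m0 : (0 < (B - 1)%:R :> R)%R by rewrite ltr0n.
rewrite -(ler_nat R) -ler_ln ?posrE ?ltr0n ?muln_gt0 ?expn_gt0 ?B10 //.
rewrite natrM !natrX lnM ?posrE ?exprn_gt0 // (_ : 4 = 2 ^+ 2)%R; last by ring.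
rewrite !lnXn //.
have BE : (B%:R - 1 = (B - 1)%:R :> R)%R by rewrite natrB // ltnW.
rewrite /log2 BE in le_k.
rewrite -(ler_pM2r ln20) mulrDl -mulrA divfK ?gt_eqF // in le_k.
rewrite addrC -[X in (_ <= X)%R]mulr_natl.
by rewrite -[X in (X + _)%R]mulr_natl -[X in (_ + X)%R]mulr_natl.
Qed.

Theorem theorem5 (R : realType) (B : nat) (hB : 2 <= B) :
  exists n : nat, forall k : nat,
    (Num.max 5 (2 * log2 (B%:R - 1 : R) + 2) <= k%:R)%R ->
    [set N : nat | Pstar_solution B k N] #= `I_n.
Proof.
have ex_k : exists k, B * (B - 1) <= 2 ^ k.
  by exists (B * (B - 1)); rewrite ltnW // ltn_expl.
(* Below this k0 the counts may differ; all admissible k are at least k0. *)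
pose k0 := ex_minn ex_k.
have [n card_k0] := (finite_setP _).1 (Pstar_solutions_finite B k0).
exists n => k; rewrite ge_max => /andP[_ /(log2_threshold hB) Bk].
have : k0 <= k by rewrite /k0; case: ex_minnP => m _; apply.
elim: k {Bk} => [|k IHk].
  by rewrite leqn0 => /eqP k00; move: card_k0; rewrite k00.
rewrite leq_eqVlt => /predU1P[<- //|]; rewrite ltnS => k0k.
apply: card_eq_trans (IHk k0k); apply: Pstar_solutions_succ => //.
have : B * (B - 1) <= 2 ^ k0 by rewrite /k0; case: ex_minnP.
by move/leq_trans; apply; rewrite leq_exp2l.
Qed.
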